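(* Let $T_1, T_2 \in \mathscr{B}(\mathscr{H})$ be analytic left invertible operators, each with Fredholm index $-1$, and let $\mathfrak{A}_i = \mathfrak{A}_{T_i}$ for $i = 1,2$. Suppose $\phi: \mathfrak{A}_1 \to \mathfrak{A}_2$ is a bounded (algebra) isomorphism. Then there exists an invertible $V \in \mathscr{B}(\mathscr{H})$ such that $\phi(A) = VAV^{-1}$ for all $A \in \mathfrak{A}_1$.
   Context: $\mathscr{H}$ is a complex Hilbert space. For a left invertible $T$, its Moore–Penrose inverse is $T^\dagger = (T^*T)^{-1}T^*$, and $\mathfrak{A}_T$ denotes the norm-closed algebra generated by $T$ and $T^\dagger$ (i.e. the operator-norm closure of the algebra of polynomials in $T$ and $T^\dagger$). A left invertible $T$ is analytic if $\bigcap_{n\ge 1} T^n\mathscr{H} = \{0\}$. *)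

(* Defs.v *)
From HB Require Import structures.
From mathcomp Require Import all_boot all_order all_algebra.
From mathcomp Require Import reals complex.
Set Implicit Arguments. Unset Strict Implicit. Unset Printing Implicit Defensive.
Import Order.TTheory GRing.Theory Num.Theory.
Local Open Scope ring_scope.

Record inner_product (R : realType) (H : lmodType R[i]) (ip : H -> H -> R[i])
  : Prop := InnerProduct {
  ip_linl : forall (a : R[i]) (x y z : H), ip (a *: x + y) z = a * ip x z + ip y z;
  ip_conj : forall x y : H, ip y x = conjc (ip x y);
  ip_pos  : forall x : H, 0 <= ip x x;
  ip_def  : forall x : H, ip x x = 0 -> x = 0 }.

Definition hnorm (R : realType) (H : lmodType R[i]) (ip : H -> H -> R[i]) (x : H)
  : R := Num.sqrt (complex.Re (ip x x)).

Definition hilbert (R : realType) (H : lmodType R[i]) (ip : H -> H -> R[i]) : Prop :=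
  inner_product ip /\
  forall u : nat -> H,
    (forall e : R, 0 < e -> exists N, forall m n, (N <= m)%N -> (N <= n)%N ->
        hnorm ip (u m - u n) < e) ->
    exists l : H, forall e : R, 0 < e -> exists N, forall n, (N <= n)%N ->
        hnorm ip (u n - l) < e.

Definition bounded_op (R : realType) (H : lmodType R[i]) (ip : H -> H -> R[i])
  (T : H -> H) : Prop :=
  (forall (a : R[i]) (x y : H), T (a *: x + y) = a *: T x + T y) /\
  exists M : R, forall x, hnorm ip (T x) <= M * hnorm ip x.

Definition adjoint (R : realType) (H : lmodType R[i]) (ip : H -> H -> R[i])
  (T S : H -> H) : Prop :=
  forall x y : H, ip (T x) y = ip x (S y).

Definition left_invertible (R : realType) (H : lmodType R[i]) (ip : H -> H -> R[i])
  (T : H -> H) : Prop :=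
  bounded_op ip T /\ exists L, bounded_op ip L /\ forall x, L (T x) = x.

Definition moore_penrose (R : realType) (H : lmodType R[i]) (ip : H -> H -> R[i])
  (T Td : H -> H) : Prop :=
  exists Ts, bounded_op ip Ts /\ adjoint ip T Ts /\
  exists G, bounded_op ip G /\ (forall x, G (Ts (T x)) = x) /\
            (forall x, Ts (T (G x)) = x) /\ (forall x, Td x = G (Ts x)).

Definition analytic (R : realType) (H : lmodType R[i]) (ip : H -> H -> R[i])
  (T : H -> H) : Prop :=
  left_invertible ip T /\
  forall x : H, (forall n, (1 <= n)%N -> exists y, x = iter n T y) -> x = 0.

Definition kernel_dim (R : realType) (H : lmodType R[i]) (T : H -> H) (k : nat) : Prop :=
  exists e : 'I_k -> H,
    (forall i, T (e i) = 0) /\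
    (forall x, T x = 0 -> exists c : 'I_k -> R[i], x = \sum_i c i *: e i) /\
    (forall c : 'I_k -> R[i], \sum_i c i *: e i = 0 -> forall i, c i = 0).

Definition cokernel_dim (R : realType) (H : lmodType R[i]) (T : H -> H) (m : nat) : Prop :=
  exists e : 'I_m -> H,
    (forall x, exists y (c : 'I_m -> R[i]), x = T y + \sum_i c i *: e i) /\
    (forall y (c : 'I_m -> R[i]), T y + \sum_i c i *: e i = 0 -> forall i, c i = 0).

Definition closed_range (R : realType) (H : lmodType R[i]) (ip : H -> H -> R[i])
  (T : H -> H) : Prop :=
  forall x : H, (forall e : R, 0 < e -> exists y, hnorm ip (x - T y) < e) ->
    exists y, x = T y.

Definition fredholm_index (R : realType) (H : lmodType R[i]) (ip : H -> H -> R[i])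
  (T : H -> H) (i : int) : Prop :=
  bounded_op ip T /\ closed_range ip T /\
  exists k m, kernel_dim T k /\ cokernel_dim T m /\ i = k%:Z - m%:Z.

Inductive poly_alg (R : realType) (H : lmodType R[i]) (T Td : H -> H)
  : (H -> H) -> Prop :=
  | pa_id : poly_alg T Td (fun x => x)
  | pa_T : poly_alg T Td T
  | pa_Td : poly_alg T Td Td
  | pa_add A B : poly_alg T Td A -> poly_alg T Td B -> poly_alg T Td (fun x => A x + B x)
  | pa_scale (a : R[i]) A : poly_alg T Td A -> poly_alg T Td (fun x => a *: A x)
  | pa_mul A B : poly_alg T Td A -> poly_alg T Td B -> poly_alg T Td (fun x => A (B x)).

Definition gen_alg (R : realType) (H : lmodType R[i]) (ip : H -> H -> R[i])
  (T Td : H -> H) (A : H -> H) : Prop :=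
  bounded_op ip A /\
  forall e : R, 0 < e -> exists P, poly_alg T Td P /\
    forall x, hnorm ip (A x - P x) <= e * hnorm ip x.

Definition bounded_alg_iso (R : realType) (H : lmodType R[i]) (ip : H -> H -> R[i])
  (A1 A2 : (H -> H) -> Prop) (phi : (H -> H) -> (H -> H)) : Prop :=
  (forall A, A1 A -> A2 (phi A)) /\
  (forall A B, A1 A -> A1 B -> (forall x, phi A x = phi B x) -> forall x, A x = B x) /\
  (forall B, A2 B -> exists A, A1 A /\ forall x, phi A x = B x) /\
  (forall A B, A1 A -> A1 B -> forall x, phi (fun y => A y + B y) x = phi A x + phi B x) /\
  (forall (a : R[i]) A, A1 A -> forall x, phi (fun y => a *: A y) x = a *: phi A x) /\
  (forall A B, A1 A -> A1 B -> forall x, phi (fun y => A (B y)) x = phi A (phi B x)) /\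
  (exists M : R, forall A, A1 A -> forall c : R, 0 <= c ->
      (forall x, hnorm ip (A x) <= c * hnorm ip x) ->
      forall x, hnorm ip (phi A x) <= M * c * hnorm ip x).

(* Main.v *)
(* Since T has index -1, E = 1 - T T^dagger is a rank one projection in the algebra A_T,
   with range spanned by some e, and analyticity of T makes A_T contain every operator
   <., y> e; so E A_T is a copy of the (conjugate) Hilbert space, on which A_T acts on the
   right. (The vectors T^n e need not span a dense subspace, so the left ideal A_T E would
   not do.) For an isomorphism phi of A_1 onto A_2, F = phi(E_1) is an idempotent of rank
   one: F A_2 F consists of multiples of F, and F A_2 E_2 is nonzero because E_1 A_1 K = 0
   forces K = 0. Hence phi maps E_1 A_1 onto F A_2, that is phi(<., y> e_1) = <., S y> f
   with S bounded and bijective, and V is the inverse of W = S^*. *)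
Require Import Defs.
From HB Require Import structures.
From mathcomp Require Import all_boot all_order all_algebra.
From mathcomp Require Import boolp classical_sets.
From mathcomp Require Import reals complex ring lra.
Set Implicit Arguments. Unset Strict Implicit. Unset Printing Implicit Defensive.
Import Order.TTheory GRing.Theory Num.Theory.
Local Open Scope ring_scope.

Local Notation Re := complex.Re.
Local Notation normc := Normc.normc.

(** * Real parts and moduli of complex numbers *)

Section ComplexNumbers.
Variable R : realType.
Implicit Types a b : R[i].

Lemma ReD a b : Re (a + b) = Re a + Re b. Proof. by case: a b => ? ? []. Qed.

Lemma ReN a : Re (- a) = - Re a. Proof. by case: a. Qed.

Lemma Re_realM (t : R) a : Re (t%:C%C * a) = t * Re a.
Proof. by case: a => u v /=; rewrite mul0r subr0. Qed.

Lemma Re_conjc a : Re (conjc a) = Re a. Proof. by case: a. Qed.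

Lemma normc_ge0 a : 0 <= normc a.
Proof. by case: a => u v; exact: sqrtr_ge0. Qed.

Lemma mul_conjc a : a * conjc a = (normc a ^+ 2)%:C%C.
Proof.
case: a => u v; rewrite sqr_sqrtr ?addr_ge0 ?sqr_ge0 //.
by apply/eqP; rewrite eq_complex /=; apply/andP; split; apply/eqP; ring.
Qed.

Lemma normc_conj a : normc (conjc a) = normc a.
Proof. by case: a => u v /=; rewrite sqrrN. Qed.

Lemma normc_real (t : R) : normc t%:C%C = `|t|.
Proof. by rewrite /= expr0n addr0 sqrtr_sqr. Qed.

Lemma normRe_le a : `|Re a| <= normc a.
Proof.
case: a => u v /=; rewrite -sqrtr_sqr ler_wsqrtr // lerDl; exact: sqr_ge0.
Qed.

End ComplexNumbers.

(** * Geometry of the inner product and its norm *)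

Section InnerProduct.
Variables (R : realType) (H : lmodType R[i]) (ip : H -> H -> R[i]).
Hypothesis ip_inner : inner_product ip.
Implicit Types (x y z : H) (a b : R[i]).

Local Notation norm := (hnorm ip).

Lemma ipDl x y z : ip (x + y) z = ip x z + ip y z.
Proof. by rewrite -[x in LHS]scale1r (ip_linl ip_inner) mul1r. Qed.

Lemma ip0l z : ip 0 z = 0.
Proof. by apply: (addIr (ip 0 z)); rewrite -ipDl !add0r. Qed.

Lemma ipZl a x z : ip (a *: x) z = a * ip x z.
Proof. by rewrite -[a *: x]addr0 (ip_linl ip_inner) ip0l addr0. Qed.

Lemma ipNl x z : ip (- x) z = - ip x z.
Proof. by rewrite -scaleN1r ipZl mulN1r. Qed.

Lemma ipBl x y z : ip (x - y) z = ip x z - ip y z.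
Proof. by rewrite ipDl ipNl. Qed.

Lemma ipDr x y z : ip x (y + z) = ip x y + ip x z.
Proof. by rewrite (ip_conj ip_inner) ipDl rmorphD /= -!(ip_conj ip_inner). Qed.

Lemma ipZr a x z : ip x (a *: z) = conjc a * ip x z.
Proof. by rewrite (ip_conj ip_inner) ipZl rmorphM /= -(ip_conj ip_inner). Qed.

Lemma ip0r x : ip x 0 = 0.
Proof. by rewrite (ip_conj ip_inner) ip0l conjc0. Qed.

Lemma ipNr x z : ip x (- z) = - ip x z.
Proof. by rewrite -scaleN1r ipZr rmorphN1 mulN1r. Qed.

Lemma ipBr x y z : ip x (y - z) = ip x y - ip x z.
Proof. by rewrite ipDr ipNr. Qed.

Definition ipE := (ipDl, ipDr, ipBl, ipBr, ipZl, ipZr, ipNl, ipNr, ip0l, ip0r).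

Lemma ip_neq0 x : x <> 0 -> ip x x != 0.
Proof. by move=> x0; apply/eqP => /(ip_def ip_inner). Qed.

Lemma ip_Re x : ip x x = (Re (ip x x))%:C%C.
Proof.
have := ip_pos ip_inner x; case: (ip x x) => u v /=.
by rewrite lecE /= => /andP[/eqP-> _].
Qed.

Lemma Re_ip_ge0 x : 0 <= Re (ip x x).
Proof. by have := ip_pos ip_inner x; rewrite lecE /= => /andP[]. Qed.

Lemma Re_ipC x y : Re (ip y x) = Re (ip x y).
Proof. by rewrite (ip_conj ip_inner) Re_conjc. Qed.

Lemma norm_ge0 x : 0 <= norm x. Proof. exact: sqrtr_ge0. Qed.

Lemma sqr_norm x : norm x ^+ 2 = Re (ip x x).
Proof. by rewrite sqr_sqrtr // Re_ip_ge0. Qed.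

Lemma norm0 : norm 0 = 0.
Proof. by rewrite /hnorm ip0l sqrtr0. Qed.

Lemma norm0_eq0 x : norm x = 0 -> x = 0.
Proof.
by move=> x0; apply: (ip_def ip_inner); rewrite ip_Re -sqr_norm x0 expr0n.
Qed.

Lemma norm_gt0 x : x <> 0 -> 0 < norm x.
Proof.
by move=> x0; rewrite lt_def norm_ge0 andbT; apply/eqP => /norm0_eq0.
Qed.

Lemma normZ a x : norm (a *: x) = normc a * norm x.
Proof.
rewrite /hnorm ipZl ipZr mulrA mul_conjc Re_realM sqrtrM ?sqr_ge0 //.
by rewrite sqrtr_sqr ger0_norm ?normc_ge0.
Qed.

Lemma normN x : norm (- x) = norm x.
Proof. by rewrite /hnorm ipNl ipNr opprK. Qed.

Lemma normBC x y : norm (x - y) = norm (y - x).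
Proof. by rewrite -opprB normN. Qed.

Lemma sqr_normD x y :
  norm (x + y) ^+ 2 = norm x ^+ 2 + 2 * Re (ip x y) + norm y ^+ 2.
Proof. rewrite !sqr_norm !ipE !ReD (Re_ipC x y); ring. Qed.

Lemma parallelogram x y :
  norm (x + y) ^+ 2 + norm (x - y) ^+ 2 = 2 * (norm x ^+ 2 + norm y ^+ 2).
Proof. rewrite !sqr_norm !ipE !(ReD, ReN); ring. Qed.

Lemma Re_ip_le x y : Re (ip x y) <= norm x * norm y.
Proof.
have [->|/eqP/norm_gt0 y0] := eqVneq y 0; first by rewrite ip0r norm0 mulr0.
(* Up to the factor [norm y ^+ 2], this is [x] minus its real projection onto [y]; scaling avoids a
   division. *)
have := Re_ip_ge0 ((norm y ^+ 2)%:C%C *: x - (Re (ip x y))%:C%C *: y).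
rewrite !ipE !conjc_real !(ReD, ReN, Re_realM) -!sqr_norm (Re_ipC x y).
set p := Re _; set u := norm x; set v := norm y in y0 *.
rewrite [X in 0 <= X](_ : _ = v ^+ 2 * ((u * v) ^+ 2 - p ^+ 2)); last by ring.
rewrite pmulr_rge0 ?exprn_gt0 // subr_ge0 => le.
have [p0|p0] := leP p 0; first by apply: le_trans p0 _; rewrite mulr_ge0 ?norm_ge0.
by rewrite -(@ler_pXn2r _ 2) // nnegrE ?mulr_ge0 ?norm_ge0 // ltW.
Qed.

(** Multiplying [x] by the conjugate of [ip x y] makes the product real, equal to the squared
    modulus; the bound on real parts then applies and one factor cancels. *)
Lemma cauchy_schwarz x y : normc (ip x y) <= norm x * norm y.
Proof.
have := Re_ip_le (conjc (ip x y) *: x) y.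
rewrite ipZl normZ normc_conj mulrC mul_conjc /=.
have := normc_ge0 (ip x y); set c := normc _ => c0.
have [->|c1] := eqVneq c 0; first by rewrite mulr_ge0 ?norm_ge0.
by rewrite -mulrA expr2 ler_pM2l // lt_def c1.
Qed.

Lemma normD_le x y : norm (x + y) <= norm x + norm y.
Proof.
rewrite -(@ler_pXn2r _ 2) ?nnegrE ?addr_ge0 ?norm_ge0 // sqr_normD.
have := Re_ip_le x y; lra.
Qed.

Lemma normB_le x y z : norm (x - z) <= norm (x - y) + norm (y - z).
Proof. by have := normD_le (x - y) (y - z); rewrite addrA subrK. Qed.

Lemma ip_eq x y : (forall z, ip x z = ip y z) -> x = y.
Proof.
by move=> e; apply/eqP; rewrite -subr_eq0; apply/eqP/(ip_def ip_inner);
  rewrite ipBl e subrr.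
Qed.

Lemma scale_inj x a b : x <> 0 -> a *: x = b *: x -> a = b.
Proof. by move=> /ip_neq0 x0 /(congr1 (ip^~ x)); rewrite !ipZl; apply: mulIf. Qed.

Hypothesis ip_complete : forall u : nat -> H,
  (forall e : R, 0 < e -> exists N, forall m n, (N <= m)%N -> (N <= n)%N ->
      norm (u m - u n) < e) ->
  exists l : H, forall e : R, 0 < e -> exists N, forall n, (N <= n)%N ->
      norm (u n - l) < e.

(** * Closed subspaces and the Riesz representation theorem *)

Definition closed_subspace (Y : H -> Prop) : Prop :=
  [/\ Y 0, forall a x y, Y x -> Y y -> Y (a *: x + y) &
      forall x, (forall e : R, 0 < e -> exists2 y, Y y & norm (x - y) < e) -> Y x].

Lemma eventually_inv_lt (e : R) : 0 < e ->
  exists N, forall n, (N <= n)%N -> n.+1%:R^-1 < e.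
Proof.
move=> e0; exists (Num.truncn e^-1) => n Nn.
rewrite -[e]invrK ltf_pV2 ?posrE ?invr_gt0 ?ltr0n //.
apply: lt_le_trans (truncnS_gt _) _; by rewrite ler_nat ltnS.
Qed.

(** First-order condition at a minimum. The test point [- a / (q + 1)] makes the quadratic negative
    unless [a] vanishes; the denominator [q + 1] also covers [q = 0]. *)
Lemma quadratic_ge0_linear (q a : R) : 0 <= q ->
  (forall t, 0 <= t ^+ 2 * q + 2 * t * a) -> a = 0.
Proof.
move=> q0 /(_ (- a / (q + 1))).
have q1 : 0 < q + 1 by lra.
have -> : (- a / (q + 1)) ^+ 2 * q + 2 * (- a / (q + 1)) * a =
          - (a ^+ 2 * (q + 2) / (q + 1) ^+ 2).
  by field; apply/eqP => ?; lra.
rewrite oppr_ge0 => le0.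
have : a ^+ 2 * (q + 2) <= 0.
  by rewrite -(pmulr_lle0 _ (_ : 0 < ((q + 1) ^+ 2)^-1)) ?invr_gt0 ?exprn_gt0.
rewrite pmulr_lle0; last lra.
by move=> le; apply/eqP; rewrite -sqrf_eq0 eq_le le sqr_ge0.
Qed.

(* The representing vector minimises y |-> |y|^2 - 2 Re (g y) on Y. *)
Lemma riesz (Y : H -> Prop) (g : H -> R[i]) (c : R) :
  closed_subspace Y ->
  (forall a x y, Y x -> Y y -> g (a *: x + y) = a * g x + g y) ->
  (forall y, Y y -> normc (g y) <= c * norm y) ->
  exists2 z, Y z & forall y, Y y -> g y = ip y z.
Proof.
move=> [Y0 Ylin Ycl] glin gle.
have Reg_le y : Y y -> `|Re (g y)| <= c * norm y.
  by move=> Yy; apply: le_trans (normRe_le _) (gle _ Yy).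
have g0 : g 0 = 0.
  have := glin 1 _ _ Y0 Y0; rewrite scale1r addr0 mul1r.
  by move=> /esym/(canRL (addrK _)) ->; rewrite subrr.
have YZ a y : Y y -> Y (a *: y) by move=> Yy; rewrite -[a *: y]addr0; apply: Ylin.
have gZ a y : Y y -> g (a *: y) = a * g y.
  by move=> Yy; rewrite -[a *: y]addr0 glin // g0 addr0.
have YD x y : Y x -> Y y -> Y (x + y).
  by move=> Yx Yy; rewrite -[x]scale1r; apply: Ylin.
have gD x y : Y x -> Y y -> g (x + y) = g x + g y.
  by move=> Yx Yy; rewrite -[x in LHS]scale1r glin // mul1r.
have YB x y : Y x -> Y y -> Y (x - y).
  by move=> Yx Yy; rewrite -scaleN1r; apply/YD/YZ.
pose J y := norm y ^+ 2 - 2 * Re (g y).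
pose E : set R := fun r => exists2 y, Y y & r = J y.
have lbE : lbound E (- c ^+ 2).
  move=> _ [y /Reg_le + ->]; rewrite ler_norml => /andP[_ le].
  have := sqr_ge0 (norm y - c); rewrite /J; nra.
have infE : has_inf E by split; [exists (J 0), 0 | exists (- c ^+ 2)].
pose d := inf E.
have dJ y : Y y -> d <= J y.
  by move=> Yy; apply: ge_inf; [case: infE | exists y].
have /choice[u uP] n : exists y, Y y /\ J y < d + n.+1%:R^-1.
  have n0 : 0 < (n.+1%:R^-1 : R) by rewrite invr_gt0 ltr0n.
  by have [_ [y Yy ->] lt] := inf_adherent n0 infE; exists y.
have Yu n : Y (u n) by case: (uP n).
have Ju n : J (u n) < d + n.+1%:R^-1 by case: (uP n).
have [|z zP] := @ip_complete u.
  move=> e e0.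
  have [|N NP] := @eventually_inv_lt (e ^+ 2 / 4).
    by rewrite divr_gt0 ?exprn_gt0 ?ltr0n.
  exists N => m n Nm Nn.
  rewrite -(@ltr_pXn2r _ 2) // ?nnegrE ?norm_ge0 ?(ltW e0) //.
  (* The midpoint of [u m] and [u n] has [J] at least [d], so the parallelogram law bounds the
     squared distance of [u m] and [u n] by twice the sum of their excesses over [d]. *)
  have := dJ _ (YZ (2^-1)%:C%C _ (YD _ _ (Yu m) (Yu n))).
  rewrite /J normZ gZ ?gD //; last exact: YD.
  rewrite Re_realM ReD normc_real ger0_norm ?invr_ge0 ?ler0n // exprMn.
  have := parallelogram (u m) (u n).
  have := Ju m; have := Ju n; rewrite /J.
  have := NP _ Nm; have := NP _ Nn.
  rewrite (_ : 2^-1 ^+ 2 = 4^-1 :> R); last by field.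
  move: (m.+1%:R^-1) (n.+1%:R^-1) => im jn; lra.
have Yz : Y z.
  apply: Ycl => e /zP[N /(_ N (leqnn N)) lt]; exists (u N) => //.
  by rewrite normBC.
have Jz : J z <= d.
  apply/ler_addgt0Pr => e e0.
  (* [J z] exceeds [J (u n)] by at most [2 * (norm z + |c|)] times the distance from [z] to [u n];
     the added 1 keeps [k] positive. *)
  pose k := 2 * (norm z + `|c|) + 1.
  have k0 : 0 < k by have := norm_ge0 z; have := normr_ge0 c; rewrite /k; lra.
  have [|N1 P1] := @eventually_inv_lt (e / 2); first lra.
  have [|N2 P2] := zP (e / 2 / k); first by rewrite divr_gt0 //; lra.
  pose n := maxn N1 N2.
  have := P1 n (leq_maxl _ _); have := P2 n (leq_maxr _ _).
  rewrite normBC ltr_pdivlMr //; set de := z - u n => lt2 lt1.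
  have uE : u n = z + (-1) *: de by rewrite scaleN1r opprB addrC subrK.
  have Yde : Y de by apply: YB.
  have : J (u n) = norm z ^+ 2 - 2 * Re (ip z de) + norm de ^+ 2
                   - 2 * Re (g z) + 2 * Re (g de).
    rewrite /J uE gD // ?gZ //; last exact: YZ.
    rewrite sqr_normD scaleN1r ipNr normN mulN1r !(ReD, ReN); ring.
  have := Ju n; have := Reg_le _ Yde; rewrite ler_norml => /andP[+ _].
  have := Re_ip_le z de; have := sqr_ge0 (norm de).
  have : c * norm de <= `|c| * norm de by rewrite ler_wpM2r ?norm_ge0 ?ler_norm.
  have := norm_ge0 de; rewrite /J; move: lt1 lt2.
  rewrite [norm de * k](_ : _ = 2 * (norm z * norm de) + 2 * (`|c| * norm de)
    + norm de); last by rewrite /k; ring.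
  move: (n.+1%:R^-1) => inv_n; lra.
(* The derivative of [J] at the minimiser [z] vanishes in the direction [y]. *)
have Re_eq y : Y y -> Re (g y) = Re (ip y z).
  move=> Yy; apply/eqP; rewrite -subr_eq0 -oppr_eq0 opprB (Re_ipC z y); apply/eqP.
  apply: (@quadratic_ge0_linear (norm y ^+ 2)); first exact: sqr_ge0.
  move=> t; have Yty : Y (t%:C%C *: y) by apply: YZ.
  have := le_trans Jz (dJ _ (YD _ _ Yz Yty)).
  rewrite /J sqr_normD gD // gZ // ReD Re_realM normZ normc_real.
  rewrite exprMn real_normK ?num_real //.
  rewrite ipZr conjc_real Re_realM; lra.
(* Equality of real parts at ['i *: y] gives equality of imaginary parts at [y]. *)
exists z => // y Yy.
have := Re_eq _ (YZ ('i)%C _ Yy); have := Re_eq _ Yy.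
rewrite gZ // ipZl.
case: (g y) (ip y z) => [a b] [a' b'] /= ->.
by rewrite !mul0r !mul1r !sub0r => /oppr_inj ->.
Qed.

(** The vector representing [ip ^~ x] on [Y] is the orthogonal projection [p] of [x], and [x - p] is
    orthogonal to [Y]. *)
Lemma orthogonal_trivial_full (Y : H -> Prop) : closed_subspace Y ->
  (forall z, (forall y, Y y -> ip z y = 0) -> z = 0) -> forall x, Y x.
Proof.
move=> Ycl perp x.
have [||p Yp px] := @riesz Y (fun y => ip y x) (norm x) Ycl.
- by move=> a y z _ _; rewrite ipDl ipZl.
- by move=> y _; rewrite mulrC; apply: cauchy_schwarz.
suff -> : x = p by [].
apply/eqP; rewrite -subr_eq0; apply/eqP/perp => y Yy.
by rewrite (ip_conj ip_inner) ipBr px // subrr conjc0.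
Qed.

(** * Bounded operators: adjoints, uniform boundedness, inverses *)

Section BoundedOperators.
Variable A : H -> H.
Hypothesis bA : bounded_op ip A.

Lemma bop_lin a x y : A (a *: x + y) = a *: A x + A y.
Proof. by case: bA. Qed.

Lemma bopD x y : A (x + y) = A x + A y.
Proof. by rewrite -[x in LHS]scale1r bop_lin scale1r. Qed.

Lemma bop0 : A 0 = 0.
Proof. by apply: (addIr (A 0)); rewrite -bopD !add0r. Qed.

Lemma bopZ a x : A (a *: x) = a *: A x.
Proof. by rewrite -[a *: x]addr0 bop_lin bop0 addr0. Qed.

Lemma bopB x y : A (x - y) = A x - A y.
Proof. by rewrite bopD -scaleN1r bopZ scaleN1r. Qed.

Lemma bop_bound : exists2 M, 0 <= M & forall x, norm (A x) <= M * norm x.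
Proof.
have [_ [M MP]] := bA; exists `|M|; first exact: normr_ge0.
move=> x; apply: le_trans (MP x) _; apply: ler_wpM2r (ler_norm _).
exact: norm_ge0.
Qed.

(** Riesz on the whole space; [y'] is the value at [y] of the adjoint of [A]. *)
Lemma adjoint_vector y : exists y', forall x, ip (A x) y = ip x y'.
Proof.
have [M M0 MP] := bop_bound.
have [||| y' _ y'P] :=
    @riesz (fun=> True) (fun x => ip (A x) y) (M * norm y).
- by split.
- by move=> a u v _ _; rewrite bop_lin ipDl ipZl.
- move=> x _; apply: le_trans (cauchy_schwarz _ _) _.
  by rewrite mulrAC ler_wpM2r ?norm_ge0.
- by exists y' => x; apply: y'P.
Qed.

End BoundedOperators.

Lemma bounded_comp A B :
  bounded_op ip A -> bounded_op ip B -> bounded_op ip (fun x => A (B x)).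
Proof.
move=> bA bB; split; first by move=> a x y; rewrite (bop_lin bB) (bop_lin bA).
have [[M M0 MP] [N N0 NP]] := (bop_bound bA, bop_bound bB).
exists (M * N) => x; apply: le_trans (MP _) _.
by rewrite -mulrA ler_wpM2l.
Qed.

Lemma bounded_add A B :
  bounded_op ip A -> bounded_op ip B -> bounded_op ip (fun x => A x + B x).
Proof.
move=> bA bB; split.
  by move=> a x y; rewrite (bop_lin bB) (bop_lin bA) scalerDr addrACA.
have [[M M0 MP] [N N0 NP]] := (bop_bound bA, bop_bound bB).
exists (M + N) => x; apply: le_trans (normD_le _ _) _.
by rewrite mulrDl lerD.
Qed.

Lemma bounded_scale a A : bounded_op ip A -> bounded_op ip (fun x => a *: A x).
Proof.
move=> bA; split.
  by move=> b x y; rewrite (bop_lin bA) scalerDr !scalerA mulrC.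
have [M M0 MP] := bop_bound bA.
exists (normc a * M) => x; rewrite normZ -mulrA ler_wpM2l //; exact: normc_ge0.
Qed.

(* Gliding hump: the limit h of steps of length 3^-n, each chosen so that the
   n-th step makes Re <h, x_n> large, beats every bound. *)
Lemma uniform_boundedness (X : H -> Prop) :
  (forall h, exists M, forall x, X x -> normc (ip h x) <= M) ->
  exists C, forall x, X x -> norm x <= C.
Proof.
move=> ptw; apply: contrapT => unb.
have {unb} /choice[x xP] n : exists x, X x /\ 3 ^+ n * n%:R < norm x.
  apply: contrapT => no; apply: unb; exists (3 ^+ n * n%:R) => x Xx.
  by rewrite leNgt; apply/negP => lt; apply: no; exists x.
have x_gt0 n : 0 < norm (x n).
  apply: le_lt_trans (proj2 (xP n)); by rewrite mulr_ge0 ?exprn_ge0 ?ler0n.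
pose r : R := 3^-1.
have rn0 n : 0 < r ^+ n by rewrite exprn_gt0 // invr_gt0 ltr0n.
(* The sign agrees with the real part already accumulated, so the next step cannot cancel it. *)
pose sg v n : R := if 0 <= Re (ip v (x n)) then 1 else -1.
pose step v n := v + (sg v n * r ^+ n / norm (x n))%:C%C *: x n.
pose h := fix h n := if n is m.+1 then step (h m) m else 0.
have sg1 v n : `|sg v n| = 1 by rewrite /sg; case: ifP; rewrite ?normrN normr1.
have step_norm v n : norm (step v n - v) = r ^+ n.
  rewrite /step addrC addKr normZ normc_real !normrM sg1 mul1r.
  rewrite normfV !gtr0_norm // divfK //; by rewrite gt_eqF.
have step_ip v n : r ^+ n * norm (x n) <= `|Re (ip (step v n) (x n))|.
  have nx := x_gt0 n; have p := mulr_gt0 (rn0 n) nx.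
  rewrite /step ipDl ipZl ReD Re_realM -sqr_norm.
  rewrite [_ / _ * _](_ : _ = sg v n * (r ^+ n * norm (x n))); last first.
    by field; rewrite gt_eqF.
  rewrite /sg; case: ifPn => [s|]; first by rewrite ger0_norm; lra.
  by rewrite -ltNge => s; rewrite ltr0_norm; lra.
(* Geometric sum, with [3 / 2 = 1 / (1 - r)]. *)
have tail n k : norm (h (n + k)%N - h n) <= 3 / 2 * (r ^+ n - r ^+ (n + k)).
  elim: k => [|k IH]; first by rewrite addn0 !subrr norm0 mulr0.
  rewrite addnS; apply: le_trans (normB_le _ (h (n + k)%N) _) _.
  rewrite [h _.+1]/(step _ _) step_norm exprSr.
  move: IH; rewrite /r; lra.
have tail_le n m : (n <= m)%N -> norm (h m - h n) <= 3 / 2 * r ^+ n.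
  move=> /subnKC <-; apply: le_trans (tail _ _) _.
  by have := rn0 (n + (m - n))%N; lra.
have r_small n : r ^+ n <= n.+1%:R^-1.
  rewrite exprVn lef_pV2 ?posrE ?exprn_gt0 ?ltr0n //.
  by rewrite -natrX ler_nat ltn_expl.
have [|l lP] := @ip_complete h.
  move=> e e0; have [|N NP] := @eventually_inv_lt (e / 3); first lra.
  exists N => m n Nm Nn; apply: le_lt_trans (normB_le _ (h N) _) _.
  have := tail_le _ _ Nm; have := tail_le _ _ Nn; rewrite [norm (h N - _)]normBC.
  have := NP N (leqnn N); have := r_small N; move: (N.+1%:R^-1) => ?; lra.
have l_near n : norm (l - h n) <= 3 / 2 * r ^+ n.
  apply/ler_addgt0Pr => e /lP[N NP].
  apply: le_trans (normB_le _ (h (maxn N n)) _) _.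
  rewrite addrC lerD ?tail_le ?leq_maxr // normBC ltW // NP // leq_maxl //.
have [M MP] := ptw l.
(* Passing from [h n.+1] to [l] costs at most half of [r ^+ n * norm (x n)], a quantity larger than
   [n]. So the pairing of [l] with [x n] exceeds [n / 2], hence [M]. *)
have [n Mn] : exists n : nat, 2 * M < n%:R.
  by exists (Num.truncn (2 * M)).+1; apply: truncnS_gt.
have [Xn lt] := xP n.
have := le_trans (normRe_le _) (MP _ Xn).
have := step_ip (h n) n; rewrite -[step _ _]/(h n.+1).
have -> : h n.+1 = l - (l - h n.+1) by rewrite opprB addrC subrK.
rewrite ipBl ReD ReN => le1 le2.
have := le_trans (normRe_le _) (cauchy_schwarz (l - h n.+1) (x n)).
have := ler_wpM2r (ltW (x_gt0 n)) (l_near n.+1).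
have := ler_normB (Re (ip l (x n))) (Re (ip (l - h n.+1) (x n))).
have : n%:R < r ^+ n * norm (x n).
  by rewrite /r exprVn ltr_pdivlMl // exprn_gt0 ?ltr0n.
rewrite [3 / 2 * r ^+ n.+1 * _](_ : _ = r ^+ n * norm (x n) / 2); last first.
  by rewrite exprSr [in X in _ * (_ * X)]/r; field.
move: (r ^+ n * norm (x n)) Mn le1 le2 => q; rewrite /r.
move: (Re (ip l _)) (Re (ip (l - _) _)) (norm (l - _) * norm _) (n%:R) => *; lra.
Qed.

(** The hypotheses say that the adjoint of [W] is surjective and injective. Surjectivity and uniform
    boundedness make [W] bounded below, so its range is closed; injectivity makes the range
    dense. *)
Lemma weakly_invertible_inverse W : bounded_op ip W ->
  (forall h, exists y, forall x, ip (W x) y = ip x h) ->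
  (forall y, (forall x, ip (W x) y = 0) -> y = 0) ->
  exists2 V, bounded_op ip V & (forall x, V (W x) = x) /\ (forall x, W (V x) = x).
Proof.
move=> bW Wadj Wdense.
(* Where [norm (W x) <= 1], the product of [x] with [h] equals that of [W x] with [y], hence has
   modulus at most [norm y]. *)
have [|C CP] := @uniform_boundedness (fun x => norm (W x) <= 1).
  move=> h; have [y yP] := Wadj h; exists (norm y) => x Wx.
  rewrite (ip_conj ip_inner) normc_conj -yP.
  apply: le_trans (cauchy_schwarz _ _) _.
  by rewrite -[leRHS]mul1r ler_wpM2r ?norm_ge0.
have Winj x : W x = 0 -> x = 0.
  move=> Wx; have [y yP] := Wadj x.
  by apply: (ip_def ip_inner); rewrite -yP Wx ip0l.
have below x : norm x <= C * norm (W x).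
  have [/Winj ->|/eqP/norm_gt0 W0] := eqVneq (W x) 0.
    by rewrite (bop0 bW) norm0 mulr0.
  have /CP : norm (W ((norm (W x))^-1%:C%C *: x)) <= 1.
    by rewrite (bopZ bW) normZ normc_real gtr0_norm ?invr_gt0 // mulVf ?gt_eqF.
  by rewrite normZ normc_real gtr0_norm ?invr_gt0 // ler_pdivrMl // mulrC.
have C0 : 0 <= `|C| by apply: normr_ge0.
have {}below x : norm x <= `|C| * norm (W x).
  apply: le_trans (below x) _; apply: ler_wpM2r (ler_norm _); exact: norm_ge0.
have [M M0 MP] := bop_bound bW.
have surj : forall x, exists v, x = W v.
  apply: orthogonal_trivial_full.
    split; first by exists 0; rewrite (bop0 bW).
      by move=> a _ _ [v ->] [w ->]; exists (a *: v + w); rewrite (bop_lin bW).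
    move=> x xcl.
    have /choice[v vP] n : exists v, norm (x - W v) < n.+1%:R^-1.
      have [|_ [v ->] lt] := xcl n.+1%:R^-1; first by rewrite invr_gt0 ltr0n.
      by exists v.
    (* The images [W (v n)] converge to [x], and the lower bound on [W] makes [v] itself a Cauchy
       sequence. *)
    have [|l lP] := @ip_complete v.
      move=> e e0; have C1 : 0 < `|C| + 1 by lra.
      have [|N NP] := @eventually_inv_lt (e / 2 / (`|C| + 1)).
        by rewrite !divr_gt0.
      exists N => m n /NP + /NP.
      have := vP m; have := vP n; rewrite !ltr_pdivlMr //.
      have := normB_le (W (v m)) x (W (v n)); rewrite [norm (W (v m) - x)]normBC.
      have := norm_ge0 (x - W (v m)); have := norm_ge0 (x - W (v n)).
      move: (m.+1%:R^-1) (n.+1%:R^-1) => im jn m0 n0 tri ltm ltn im_lt jn_lt.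
      apply: le_lt_trans (below _) _; rewrite (bopB bW).
      apply: (@le_lt_trans _ _ (`|C| * (im + jn))); last by nra.
      apply: ler_wpM2l => //; lra.
    exists l; apply/eqP; rewrite -subr_eq0; apply/eqP/norm0_eq0/eqP.
    rewrite eq_le norm_ge0 andbT; apply/ler_addgt0Pr => e e0; rewrite add0r.
    have [|N1 P1] := @eventually_inv_lt (e / 2); first lra.
    have [|N2 P2] := lP (e / 2 / (M + 1)); first by rewrite !divr_gt0 //; lra.
    pose n := maxn N1 N2.
    have := P1 n (leq_maxl _ _); have := P2 n (leq_maxr _ _); have := vP n.
    rewrite ltr_pdivlMr; last lra.
    have := normB_le x (W (v n)) (W l); have := MP (v n - l); rewrite (bopB bW).
    have := norm_ge0 (v n - l); move: (n.+1%:R^-1) => ?; nra.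
  move=> z zP; apply: Wdense => x.
  by rewrite (ip_conj ip_inner) zP ?conjc0 //; exists x.
have /choice[V VP] := surj; exists V; last first.
  split=> x; last by rewrite -VP.
  apply/eqP; rewrite -subr_eq0; apply/eqP/Winj.
  by rewrite (bopB bW) -VP subrr.
split; last by exists `|C| => x; rewrite [in leRHS](VP x).
move=> a x y; apply/eqP; rewrite -subr_eq0; apply/eqP/Winj.
by rewrite (bopB bW) (bop_lin bW) -!VP subrr.
Qed.

(** * Rank one operators *)

Definition rank_one (e y : H) : H -> H := fun x => ip x y *: e.

Lemma norm_rank_one e y x : norm (rank_one e y x) <= norm e * norm y * norm x.
Proof.
rewrite normZ -mulrA mulrC ler_wpM2l ?norm_ge0 //.
by rewrite mulrC cauchy_schwarz.
Qed.

Lemma bounded_rank_one e y : bounded_op ip (rank_one e y).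
Proof.
split; last by exists (norm e * norm y); exact: norm_rank_one.
by move=> a u v; rewrite /rank_one ipDl ipZl scalerDl scalerA.
Qed.

Definition operator_algebra (A : (H -> H) -> Prop) : Prop :=
  [/\ forall B, A B -> bounded_op ip B,
      forall B C, A B -> A C -> A (fun x => B (C x)) &
      forall a B, A B -> A (fun x => a *: B x)].

(** * Isomorphisms between algebras containing rank one operators *)

Section SpatialIsomorphism.
Variables (A1 A2 : (H -> H) -> Prop) (e1 e2 : H).
Hypotheses (alg1 : operator_algebra A1) (alg2 : operator_algebra A2).
Hypotheses (e1_neq0 : e1 <> 0) (e2_neq0 : e2 <> 0).
Hypothesis rank_one1 : forall y, A1 (rank_one e1 y).
Hypothesis rank_one2 : forall y, A2 (rank_one e2 y).
Variable phi : (H -> H) -> (H -> H).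
Hypothesis phi_iso : bounded_alg_iso ip A1 A2 phi.

Let A1_bounded B : A1 B -> bounded_op ip B. Proof. by case: alg1 => + _ _; apply. Qed.
Let A1_mul B C : A1 B -> A1 C -> A1 (fun x => B (C x)).
Proof. by case: alg1 => _ + _; apply. Qed.
Let A1_scale a B : A1 B -> A1 (fun x => a *: B x).
Proof. by case: alg1 => _ _; apply. Qed.
Let A2_bounded B : A2 B -> bounded_op ip B. Proof. by case: alg2 => + _ _; apply. Qed.
Let A2_mul B C : A2 B -> A2 C -> A2 (fun x => B (C x)).
Proof. by case: alg2 => _ + _; apply. Qed.

Let phi_range B : A1 B -> A2 (phi B).
Proof. by case: phi_iso => + _; apply. Qed.

Let phi_inj B C : A1 B -> A1 C -> (forall x, phi B x = phi C x) -> forall x, B x = C x.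
Proof. by case: phi_iso => _ [+ _]; apply. Qed.

Let phi_surj B : A2 B -> exists2 C, A1 C & phi C = B.
Proof.
by case: phi_iso => _ [_ [+ _]] => /[apply] -[C [? e]]; exists C => //; apply: funext.
Qed.

Let phiD B C x : A1 B -> A1 C -> phi (fun y => B y + C y) x = phi B x + phi C x.
Proof. by case: phi_iso => _ [_ [_ [+ _]]] => h ? ?; apply: h. Qed.

Let phiZ a B x : A1 B -> phi (fun y => a *: B y) x = a *: phi B x.
Proof. by case: phi_iso => _ [_ [_ [_ [+ _]]]] => h ?; apply: h. Qed.

Let phiM B C x : A1 B -> A1 C -> phi (fun y => B (C y)) x = phi B (phi C x).
Proof. by case: phi_iso => _ [_ [_ [_ [_ [+ _]]]]] => h ? ?; apply: h. Qed.

Let phi_bounded : exists M : R, forall A, A1 A -> forall c : R, 0 <= c ->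
  (forall x, norm (A x) <= c * norm x) ->
  forall x, norm (phi A x) <= M * c * norm x.
Proof. by case: phi_iso => _ [_ [_ [_ [_ [_ +]]]]]. Qed.

Let phi_inj0 B : A1 B -> (forall x, phi B x = 0) -> forall x, B x = 0.
Proof.
move=> AB B0 x; rewrite -[RHS](scale0r (B x)).
by apply: (phi_inj AB (A1_scale 0 AB)) => z; rewrite phiZ // B0 scaler0.
Qed.

(** Normalised so that [rank_one e1 y1] is the orthogonal projection onto the line of [e1]. *)
Let y1 : H := conjc (ip e1 e1)^-1 *: e1.

Let ip_e1y1 : ip e1 y1 = 1.
Proof. by rewrite /y1 ipZr conjcK mulVf // ip_neq0. Qed.

Let E1 := rank_one e1 y1.

Let E1_rank_one y x : E1 (rank_one e1 y x) = rank_one e1 y x.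
Proof. by rewrite /E1 /rank_one ipZl ip_e1y1 mulr1. Qed.

Let F := phi E1.

Let F_linear : bounded_op ip F. Proof. exact/A2_bounded/phi_range/rank_one1. Qed.

Let F_phi y x : F (phi (rank_one e1 y) x) = phi (rank_one e1 y) x.
Proof.
rewrite /F -(phiM _ (rank_one1 _) (rank_one1 _)); congr (phi _ x).
by apply: funext => z; exact: E1_rank_one.
Qed.

(** Otherwise let [phi K = rank_one e2 e2]. Each [phi (rank_one e1 y)] has range fixed by [F], so it
    kills [e2]; hence [rank_one e1 y] annihilates the range of [K] for all [y]. Then [K] is zero,
    although [phi K] is not. *)
Let F_nonzero : exists2 B, A2 B & F (B e2) <> 0.
Proof.
apply: contrapT => no.
have FB0 B : A2 B -> F (B e2) = 0.
  by move=> AB; apply: contrapT => F0; apply: no; exists B.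
have [K AK phiK] := phi_surj (rank_one2 e2).
have K0 x : K x = 0.
  apply: ip_eq => y; rewrite ip0l; apply: (scale_inj e1_neq0); rewrite scale0r.
  apply: (phi_inj0 (A1_mul (rank_one1 y) AK)) => z; rewrite phiM // phiK.
  have AB := phi_range (rank_one1 y).
  by rewrite /rank_one (bopZ (A2_bounded AB)) -F_phi FB0 ?scaler0.
have /(scale_inj e2_neq0)/eqP : ip e2 e2 *: e2 = 0 *: e2.
  rewrite scale0r -[LHS]/(rank_one e2 e2 e2) -phiK.
  suff -> : K = fun x => 0 *: K x by rewrite phiZ // scale0r.
  by apply: funext => x; rewrite K0 scaler0.
by rewrite (negPf (ip_neq0 e2_neq0)).
Qed.

(* E1 A1 E1 consists of the multiples of E1, hence F A2 F of the multiples of F;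
   for the product of F with an operator of range spanned by B e2 this says that
   F itself has range spanned by F (B e2). *)
Let F_rank_one B : A2 B -> F (B e2) <> 0 -> forall x, exists c, F x = c *: F (B e2).
Proof.
move=> AB; set f := F (B e2) => f0.
have [K AK phiK] := phi_surj (A2_mul AB (rank_one2 f)).
(* Both sides are [F (phi K (F x))]: the left from [phi K = B (rank_one e2 f)], the right from
   [E1 K E1] being a multiple of [E1]. *)
have FKF x : ip (F x) f *: f = ip (K e1) y1 *: F x.
  have <- : phi (fun x => E1 (K (E1 x))) x = ip (K e1) y1 *: F x.
    rewrite /F -(phiZ _ _ (rank_one1 y1)); congr (phi _ x); apply: funext => z.
    by rewrite /E1 /rank_one (bopZ (A1_bounded AK)) ipZl !scalerA mulrC.
  rewrite (phiM _ (rank_one1 _) (A1_mul AK (rank_one1 _))).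
  rewrite (phiM _ AK (rank_one1 _)) phiK -/F.
  by rewrite /rank_one (bopZ (A2_bounded AB)) (bopZ F_linear).
have l0 : ip (K e1) y1 != 0.
  apply/eqP => l0; have := FKF (B e2); rewrite l0 -/f => /(scale_inj f0)/eqP.
  by rewrite (negPf (ip_neq0 f0)).
move=> x; exists ((ip (K e1) y1)^-1 * ip (F x) f).
by rewrite -scalerA FKF scalerA mulVf // scale1r.
Qed.

(* The isomorphism maps the right ideal E1 A1 = {rank_one e1 y} onto F A2, which is
   {rank_one f y}; the induced bijection on y is the adjoint of W. *)
Lemma isomorphism_spatial : exists V W : H -> H,
  bounded_op ip V /\ bounded_op ip W /\
  (forall x, V (W x) = x) /\ (forall x, W (V x) = x) /\
  forall A, A1 A -> forall x, phi A x = V (A (W x)).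
Proof.
have [B AB] := F_nonzero; move: (F_rank_one AB).
have Ff : F (F (B e2)) = F (B e2).
  rewrite {1 2}/F -(phiM _ (rank_one1 _) (rank_one1 _)); congr (phi _ _).
  by apply: funext => z; exact: E1_rank_one.
have AFB y : A2 (fun x => F (B (rank_one e2 y x))).
  by apply: A2_mul; [apply/phi_range/rank_one1 | apply: A2_mul].
have FBE x y : F (B (rank_one e2 y x)) = ip x y *: F (B e2).
  by rewrite /rank_one (bopZ (A2_bounded AB)) (bopZ F_linear).
move: (F (B e2)) Ff FBE => f Ff FBE + f0 => /(_ f0) F_span.
pose s y x := ip (phi (rank_one e1 y) x) f / ip f f.
have sE y x : phi (rank_one e1 y) x = s y x *: f.
  rewrite /s -F_phi; have [c ->] := F_span (phi (rank_one e1 y) x).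
  by rewrite ipZl mulfK // ip_neq0.
have [M MP] := phi_bounded; have M0 := normr_ge0 M.
have s_le y x : normc (s y x) * norm f <= `|M| * (norm e1 * norm y) * norm x.
  have e1y0 : 0 <= norm e1 * norm y by rewrite mulr_ge0 ?norm_ge0.
  rewrite -normZ -sE.
  apply: le_trans (MP _ _ _ e1y0 (norm_rank_one _ _) x) _ => //.
  by rewrite -!mulrA ler_wpM2r ?ler_norm // mulr_ge0 ?mulr_ge0 ?norm_ge0.
have fgt0 := norm_gt0 f0.
(* [rank_one e1 y] is conjugate linear in [y], so conjugating the coefficient [s y x] gives a linear
   functional of [y], bounded by [s_le]; [W x] represents it. *)
have /choice[W WP] x : exists w, forall y, phi (rank_one e1 y) x = ip w y *: f.
  have [||| w _ wP] :=
      @riesz (fun=> True) (fun y => conjc (s y x)) (`|M| * norm e1 * norm x / norm f).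
  - by split.
  - move=> a y z _ _; rewrite -[a in RHS]conjcK -rmorphM -rmorphD /=; congr conjc.
    apply: (scale_inj f0); rewrite -sE scalerDl -scalerA -!sE -phiZ // -phiD //.
      congr (phi _ x); apply: funext => v.
      by rewrite /rank_one ipDr ipZr scalerDl scalerA.
    exact: A1_scale.
  - move=> y _; rewrite normc_conj mulrAC ler_pdivlMr //.
    by apply: le_trans (s_le _ _) _; rewrite !mulrA [leRHS]mulrAC.
  exists w => y; rewrite sE -[s y x]conjcK wP //.
  by rewrite -(ip_conj ip_inner).
have WPf x y c : phi (rank_one e1 y) x = c *: f -> ip (W x) y = c.
  by rewrite WP => /(scale_inj f0).
have bW : bounded_op ip W.
  split.
    move=> a x y; apply: ip_eq => z; apply: WPf.
    rewrite (bop_lin (A2_bounded (phi_range (rank_one1 z)))) !WP.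
    by rewrite ipDl ipZl scalerDl scalerA.
  exists (`|M| * norm e1 / norm f) => x; rewrite mulrAC ler_pdivlMr //.
  have [->|/eqP/norm_gt0 W0] := eqVneq (W x) 0.
    by rewrite norm0 mul0r !mulr_ge0 ?norm_ge0.
  rewrite -(ler_pM2r W0).
  (* With [y = W x] the coefficient is [norm (W x) ^+ 2]; one factor then cancels. *)
  have := s_le (W x) x.
  have -> : s (W x) x = ip (W x) (W x) by apply: (scale_inj f0); rewrite -sE.
  rewrite ip_Re -sqr_norm normc_real ger0_norm ?sqr_ge0 // => le.
  rewrite [leLHS](_ : _ = norm (W x) ^+ 2 * norm f); last by ring.
  by apply: le_trans le _; rewrite le_eqVlt; apply/orP/or_introl/eqP; ring.
have [||V bV [VW WV]] := weakly_invertible_inverse bW.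
(* Here [phi K] is [rank_one f h]. As [F f = f], also [E1 K = K], so [K] is [rank_one e1 y] with [y]
   the adjoint of [K] applied to [y1]. *)
- move=> h; have [K AK phiK] := phi_surj (AFB h).
  have EK x : E1 (K x) = K x.
    apply: (phi_inj (A1_mul (rank_one1 _) AK) AK) => z.
    by rewrite phiM // phiK -/F FBE (bopZ F_linear) Ff.
  have [y yP] := adjoint_vector (A1_bounded AK) y1.
  exists y => x; apply: WPf; rewrite -FBE; apply: etrans (congr1 (@^~ x) phiK).
  congr (phi _ x).
  by apply: funext => z; rewrite -EK /E1 /rank_one -yP.
- move=> y Wy; apply: (ip_def ip_inner); apply: (scale_inj e1_neq0); rewrite scale0r.
  by apply: (phi_inj0 (rank_one1 y)) => x; rewrite WP Wy scale0r.
exists V, W; do !split => //.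
move=> A AA x; rewrite -[LHS]VW; congr (V _).
(* [rank_one e1 y] composed with [A] is [rank_one e1 y']; applying [phi] gives
   [W (phi A x) = A (W x)]. *)
apply: ip_eq => y; have [y' y'P] := adjoint_vector (A1_bounded AA) y.
rewrite y'P; apply: WPf; rewrite -WP -phiM //; congr (phi _ x).
by apply: funext => z; rewrite /rank_one y'P.
Qed.

End SpatialIsomorphism.

(** * The norm-closed algebra generated by an operator and its Moore-Penrose inverse *)

Section GeneratedAlgebra.
Variables T Td : H -> H.
Hypotheses (bT : bounded_op ip T) (bTd : bounded_op ip Td).

Lemma poly_alg_bounded P : poly_alg T Td P -> bounded_op ip P.
Proof.
elim=> {P} // [|A B _ bA _ bB|a A _ bA|A B _ bA _ bB].
- by split=> //; exists 1 => x; rewrite mul1r.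
- exact: bounded_add.
- exact: bounded_scale.
- exact: bounded_comp.
Qed.

Lemma gen_alg_poly P : poly_alg T Td P -> gen_alg ip T Td P.
Proof.
move=> pP; split; first exact: poly_alg_bounded.
move=> e e0; exists P; split=> // x.
by rewrite subrr norm0 mulr_ge0 ?norm_ge0 // ltW.
Qed.

Lemma gen_alg_add A B :
  gen_alg ip T Td A -> gen_alg ip T Td B -> gen_alg ip T Td (fun x => A x + B x).
Proof.
move=> [bA Ae] [bB Be]; split; first exact: bounded_add.
move=> e e0; have e20 : 0 < e / 2 by lra.
have [[P [pP PA]] [Q [pQ QB]]] := (Ae _ e20, Be _ e20).
exists (fun x => P x + Q x); split; first exact: pa_add.
move=> x; rewrite opprD addrACA; apply: le_trans (normD_le _ _) _.
by have := PA x; have := QB x; lra.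
Qed.

Lemma gen_alg_scale a A :
  gen_alg ip T Td A -> gen_alg ip T Td (fun x => a *: A x).
Proof.
move=> [bA Ae]; split; first exact: bounded_scale.
move=> e e0; have a0 := normc_ge0 a; have a1 : 0 < normc a + 1 by lra.
have [P [pP PA]] := Ae _ (divr_gt0 e0 a1).
exists (fun x => a *: P x); split; first exact: pa_scale.
move=> x; rewrite -scalerBr normZ.
apply: le_trans (ler_wpM2l a0 (PA x)) _; rewrite mulrA ler_wpM2r ?norm_ge0 //.
by rewrite mulrA ler_pdivrMr // mulrC ler_pM2l //; lra.
Qed.

Lemma gen_alg_mul A B :
  gen_alg ip T Td A -> gen_alg ip T Td B -> gen_alg ip T Td (fun x => A (B x)).
Proof.
move=> [bA Ae] [bB Be]; split; first exact: bounded_comp.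
have [[M M0 MP] [N N0 NP]] := (bop_bound bA, bop_bound bB).
(* [d <= 1] gives [norm (Q x) <= (N + 1) * norm x], so the total error is at most
   [d * (M + N + 1) * norm x]. *)
move=> e e0; pose d := Num.min 1 (e / (M + N + 1)).
have MN1 : 0 < M + N + 1 by lra.
have d0 : 0 < d by rewrite lt_min ltr01 divr_gt0.
have d1 : d <= 1 by rewrite ge_min lexx.
have de : d * (M + N + 1) <= e by rewrite -ler_pdivlMr // ge_min lexx orbT.
have [[P [pP PA]] [Q [pQ QB]]] := (Ae _ d0, Be _ d0).
exists (fun x => P (Q x)); split; first exact: pa_mul.
move=> x; apply: le_trans (normB_le _ (A (Q x)) _) _.
have le1 : norm (A (B x) - A (Q x)) <= M * d * norm x.
  rewrite -(bopB bA); apply: le_trans (MP _) _.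
  by rewrite -mulrA ler_wpM2l.
have le2 : norm (Q x) <= (N + 1) * norm x.
  rewrite -[Q x](subKr (B x)).
  apply: le_trans (normD_le _ _) _; rewrite normN.
  have := NP x; have := QB x; have := norm_ge0 x.
  nra.
have := PA (Q x); have := ler_wpM2l (ltW d0) le2.
have := ler_wpM2r (norm_ge0 x) de; lra.
Qed.

Lemma gen_alg_operator_algebra : operator_algebra (gen_alg ip T Td).
Proof.
by split=> [B []||] //; [exact: gen_alg_mul | exact: gen_alg_scale].
Qed.

Lemma gen_alg_closed A : bounded_op ip A ->
  (forall e, 0 < e -> exists2 B, gen_alg ip T Td B &
     forall x, norm (A x - B x) <= e * norm x) ->
  gen_alg ip T Td A.
Proof.
move=> bA Acl; split=> // e e0; have e20 : 0 < e / 2 by lra.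
have [B [bB Be] AB] := Acl _ e20; have [P [pP PB]] := Be _ e20.
exists P; split=> // x; apply: le_trans (normB_le _ (B x) _) _.
by have := AB x; have := PB x; lra.
Qed.

(* 1 - T Td is the rank one projection onto the kernel of the adjoint of T,
   spanned by e. The operators (1 - T Td) Td^m are <., y_m> e, and the y_m span a
   dense subspace because T is analytic. *)
Lemma gen_alg_rank_one : analytic ip T -> fredholm_index ip T (-1) ->
  moore_penrose ip T Td ->
  exists2 e, e <> 0 & forall y, gen_alg ip T Td (rank_one e y).
Proof.
move=> [[_ [L [bL LT]]] Tan] [_ [_ [k [m [ker_k [coker_m index]]]]]].
move=> [Ts [bTs [Tadj [G [bG [GTsT [TsTG TdE]]]]]]].
(* A left invertible operator has trivial kernel, so index -1 forces a cokernel of dimension one. *)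
have k0 : k = 0.
  case: k ker_k index => // k [u [u0 [_ ufree]]] _.
  have uz i : u i = 0 by rewrite -[u i]LT u0 (bop0 bL).
  have := ufree (fun=> 1); rewrite big1 => [|i _]; last by rewrite uz scaler0.
  by move=> /(_ erefl ord0)/eqP; rewrite oner_eq0.
have m1 : m = 1%N by move: index; rewrite k0 sub0r => /oppr_inj [<-].
move: coker_m; rewrite m1 => -[u [uspan ufree]].
pose e0 := u ord0; pose E x := x + (-1) *: T (Td x).
have EE x : E x = x - T (Td x) by rewrite /E scaleN1r.
have TdT x : Td (T x) = x by rewrite TdE GTsT.
have pE : poly_alg T Td E.
  by apply: pa_add; [exact: pa_id | apply/pa_scale/pa_mul; constructor].
have bE := poly_alg_bounded pE.
pose e := E e0.
have e_neq0 : e <> 0.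
  rewrite /e EE => /eqP; rewrite subr_eq0 => /eqP e0E.
  have := ufree (- Td e0) (fun=> 1); rewrite big_ord1 scale1r -/e0 {2}e0E.
  rewrite -(bopD bT) addNr (bop0 bT) => /(_ erefl ord0)/eqP.
  by rewrite oner_eq0.
have Tse : Ts e = 0 by rewrite /e EE (bopB bTs) TdE TsTG subrr.
(* [E] kills the range of [T], which together with [e0] spans the space; pairing with [e], which is
   orthogonal to that range, gives the coefficient. *)
have ETr x : E x = (ip x e / ip e e) *: e.
  have [y [c xE]] := uspan x; rewrite big_ord1 in xE.
  have Ex : E x = c ord0 *: e.
    by rewrite xE (bopD bE) (bopZ bE) EE TdT subrr add0r.
  have : ip (E x) e = ip x e by rewrite EE ipBl Tadj Tse ip0r subr0.
  by rewrite Ex ipZl => <-; rewrite mulfK // ip_neq0.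
have pTd j : poly_alg T Td (fun x => iter j Td x).
  elim: j => [|j IH]; first exact: pa_id.
  exact: (pa_mul (pa_Td _ _) IH).
exists e => //; apply: orthogonal_trivial_full.
  split.
  - have -> : rank_one e 0 = fun x => 0 *: x.
      by apply: funext => x; rewrite /rank_one ip0r !scale0r.
    exact/gen_alg_scale/gen_alg_poly/pa_id.
  - move=> a x y Yx Yy.
    have -> : rank_one e (a *: x + y) =
              fun z => conjc a *: rank_one e x z + rank_one e y z.
      by apply: funext => z; rewrite /rank_one ipDr ipZr scalerDl scalerA.
    by apply: gen_alg_add => //; apply: gen_alg_scale.
  - move=> x xcl; apply: (gen_alg_closed (bounded_rank_one _ _)) => d d0.
    have [|y Yy xy] := xcl (d / norm e); first by rewrite divr_gt0 // norm_gt0.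
    exists (rank_one e y) => // z.
    rewrite /rank_one -scalerBl -ipBr.
    apply: le_trans (norm_rank_one _ _ _) _; rewrite ler_wpM2r ?norm_ge0 //.
    by rewrite mulrC -ler_pdivlMr ?norm_gt0 // ltW.
(* [z] is orthogonal to the vector [y] with [rank_one e y] a multiple of [E Td^j]. *)
move=> z zP; have ETd j : E (iter j Td z) = 0.
  have [y yP] := adjoint_vector (poly_alg_bounded (pTd j)) e.
  rewrite ETr yP zP ?mul0r ?scale0r //.
  have -> : rank_one e y = fun x => ip e e *: E (iter j Td x).
    apply: funext => x; rewrite /rank_one -yP ETr scalerA mulrCA mulfV ?mulr1 //.
    exact: ip_neq0.
  exact/gen_alg_scale/gen_alg_poly/(pa_mul pE).
(* Since [E] kills [Td^j z], the operator [T Td] fixes it; thus [z] lies in the range of every power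
   of [T]. *)
have zE j : z = iter j T (iter j Td z).
  elim: j => // j IH; rewrite iterSr iterS -[T _](subKr (iter j Td z)).
  by rewrite -EE ETd subr0.
by apply: Tan => n _; exists (iter n Td z).
Qed.

End GeneratedAlgebra.

End InnerProduct.

(** * Similarity of the algebras of two analytic operators of index -1 *)

Theorem theoremB (R : realType) (H : lmodType R[i]) (ip : H -> H -> R[i])
  (T1 T2 T1d T2d : H -> H) (phi : (H -> H) -> (H -> H)) :
  hilbert ip ->
  analytic ip T1 -> analytic ip T2 ->
  fredholm_index ip T1 (-1) -> fredholm_index ip T2 (-1) ->
  moore_penrose ip T1 T1d -> moore_penrose ip T2 T2d ->
  bounded_alg_iso ip (gen_alg ip T1 T1d) (gen_alg ip T2 T2d) phi ->
  exists V W : H -> H,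
    bounded_op ip V /\ bounded_op ip W /\
    (forall x, V (W x) = x) /\ (forall x, W (V x) = x) /\
    forall A, gen_alg ip T1 T1d A -> forall x, phi A x = V (A (W x)).
Proof.
move=> [ipi ipc] an1 an2 ind1 ind2 mp1 mp2 iso.
have bT1 := proj1 ind1; have bT2 := proj1 ind2.
have bTd T Td : moore_penrose ip T Td -> bounded_op ip Td.
  move=> [Ts [bTs [_ [G [bG [_ [_ /funext ->]]]]]]].
  exact: bounded_comp.
have [bT1d bT2d] := (bTd _ _ mp1, bTd _ _ mp2).
have [e1 e1_neq0 r1] := gen_alg_rank_one ipi ipc bT1 bT1d an1 ind1 mp1.
have [e2 e2_neq0 r2] := gen_alg_rank_one ipi ipc bT2 bT2d an2 ind2 mp2.
exact: (isomorphism_spatial ipi ipc (gen_alg_operator_algebra ipi T1 T1d)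
  (gen_alg_operator_algebra ipi T2 T2d) e1_neq0 e2_neq0 r1 r2 iso).
Qed.
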